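(* Let $a>0$, let $Q$ be a continuous complex-valued non-vanishing function on $[-a,a]$, and let $P=Q^{\ast}$ be its complex conjugate. Let $v_0$ be a particular non-vanishing solution on $[-a,a]$ of the equation $$\left(\frac{1}{Q}v'\right)'+Pv=0$$ such that $v_0\in C^1[-a,a]$, $\frac{v_0'}{Q}\in C^1[-a,a]$ and the functions $v_0^2\frac{Q'}{Q^2}$, $\frac{v_0^2}{Q}$ and $\frac{Q}{v_0^2}$ are continuous on $[-a,a]$. Let the functions $X^{(n)}$ be defined by the recursive integrals given in the context (with initial integration point $-a$). Then a complex number $\lambda$ with $\operatorname{Re}\lambda>0$ is an eigenvalue of the spectral problem $$v_1'=\lambda v_1+Pv_2,\qquad v_2'=-\lambda v_2-Qv_1\quad\text{on }(-a,a),$$ $$v_1(-a)=1,\qquad v_2(-a)=0,\qquad v_1(a)=0,$$ if and only if $$\sum_{k=0}^{\infty}\lambda^k\Bigl(v_0(a)\bigl(v_0'(a)X^{(2k+1)}(a)+v_0(a)X^{(2k-1)}(a)\bigr)+Q(a)X^{(2k)}(a)\Bigr)=0.$$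
   Context: A number $\lambda$ with $\operatorname{Re}\lambda>0$ is called an eigenvalue of the spectral problem if there exists a solution $(v_1,v_2)$ of the system satisfying all the listed boundary conditions (the problem arises from the Zakharov-Shabat system whose potential $Q$ is compactly supported on $[-a,a]$). The functions $X^{(n)}$ on $[-a,a]$, $n\in\mathbb{Z}$, are defined by $X^{(n)}\equiv 0$ for $n<0$, $X^{(0)}\equiv 1$, and, for $n\ge 1$, $$X^{(n)}(x)=\begin{cases}\displaystyle\int_{-a}^{x}X^{(n-1)}(y)\frac{Q(y)}{v_0^2(y)}\,dy, & n\text{ odd},\\[2mm] \displaystyle\int_{-a}^{x}\left(X^{(n-1)}(y)\,v_0^2(y)\frac{Q'(y)}{Q^2(y)}+X^{(n-3)}(y)\frac{v_0^2(y)}{Q(y)}\right)dy, & n\text{ even}.\end{cases}$$ Here $Q$ is differentiable on $[-a,a]$ with derivative $Q'$ (implicit in the hypotheses). Solutions are classical complex-valued solutions (on the closed segment $[-a,a]$, so that boundary values make sense). *)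

(* Defs.v *)
From Stdlib Require Import Reals ZArith Lia.
From Coquelicot Require Import Coquelicot.

Local Open Scope R_scope.

Definition segment (a x : R) : Prop := - a <= x <= a.

(* [l] is the derivative of [f] at [x] relative to [-a,a]: the two-sided
   derivative at interior points, the one-sided one at -a and at a. *)
Definition is_derive_seg (a : R) (f : R -> C) (x : R) (l : C) : Prop :=
  filterdiff (K := R_AbsRing) (U := R_NormedModule) (V := C_R_NormedModule)
    f (within (segment a) (locally x)) (fun h : R => scal h l).

(* [f] is differentiable on [-a,a] with derivative [df]. *)
Definition has_derivative (a : R) (f df : R -> C) : Prop :=
  forall x, segment a x -> is_derive_seg a f x (df x).

(* [f] belongs to C^1[-a,a], with derivative [df]. *)
Definition C1_seg (a : R) (f df : R -> C) : Prop :=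
  has_derivative a f df /\ continuous_on (segment a) df.

Local Open Scope C_scope.

(* Functions of index n >= 0; the missing function of index -1 in the case
   n = 2 is zero. *)
Fixpoint Xnat (a : R) (Q dQ v0 : R -> C) (n : nat) (x : R) : C :=
  match n with
  | O => 1
  | S m =>
      if Nat.odd (S m) then
        RInt (V := C_R_CompleteNormedModule)
          (fun y => Xnat a Q dQ v0 m y * (Q y / v0 y ^ 2)) (- a)%R x
      else
        RInt (V := C_R_CompleteNormedModule)
          (fun y =>
             Xnat a Q dQ v0 m y * (v0 y ^ 2 * (dQ y / Q y ^ 2))
             + match m with
               | S (S p) => Xnat a Q dQ v0 p y
               | _ => 0
               end * (v0 y ^ 2 / Q y)) (- a)%R x
  end.

Definition X (a : R) (Q dQ v0 : R -> C) (n : Z) (x : R) : C :=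
  if (n <? 0)%Z then 0 else Xnat a Q dQ v0 (Z.to_nat n) x.

Lemma X_neg (a : R) (Q dQ v0 : R -> C) (n : Z) (x : R) :
  (n < 0)%Z -> X a Q dQ v0 n x = 0.
Proof. intros H; unfold X; apply Z.ltb_lt in H; now rewrite H. Qed.

Lemma X_0 (a : R) (Q dQ v0 : R -> C) (x : R) : X a Q dQ v0 0 x = 1.
Proof. reflexivity. Qed.

Lemma X_of_nat (a : R) (Q dQ v0 : R -> C) (n : nat) (x : R) :
  X a Q dQ v0 (Z.of_nat n) x = Xnat a Q dQ v0 n x.
Proof.
unfold X; rewrite Nat2Z.id.
destruct (Z.ltb_spec (Z.of_nat n) 0) as [H|H]; [lia|reflexivity].
Qed.

Lemma X_odd (a : R) (Q dQ v0 : R -> C) (n : Z) (x : R) :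
  (1 <= n)%Z -> Z.odd n = true ->
  X a Q dQ v0 n x =
  RInt (V := C_R_CompleteNormedModule)
    (fun y => X a Q dQ v0 (n - 1) y * (Q y / v0 y ^ 2)) (- a)%R x.
Proof.
intros Hn Ho.
destruct (Z_of_nat_complete n) as [[|m] ->]; try lia.
rewrite X_of_nat; cbn [Xnat].
replace (Nat.odd (S m)) with true.
- apply (RInt_ext (V := C_R_CompleteNormedModule)); intros y _.
  now replace (Z.of_nat (S m) - 1)%Z with (Z.of_nat m) by lia; rewrite X_of_nat.
- symmetry; apply Nat.odd_spec; apply Z.odd_spec in Ho; destruct Ho as [k Hk].
  exists (Z.to_nat k); lia.
Qed.

Lemma X_even (a : R) (Q dQ v0 : R -> C) (n : Z) (x : R) :
  (1 <= n)%Z -> Z.even n = true ->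
  X a Q dQ v0 n x =
  RInt (V := C_R_CompleteNormedModule)
    (fun y =>
       X a Q dQ v0 (n - 1) y * (v0 y ^ 2 * (dQ y / Q y ^ 2))
       + X a Q dQ v0 (n - 3) y * (v0 y ^ 2 / Q y)) (- a)%R x.
Proof.
intros Hn He.
destruct (Z_of_nat_complete n) as [[|m] ->]; try lia.
rewrite X_of_nat; cbn [Xnat].
apply Z.even_spec in He; destruct He as [k Hk].
replace (Nat.odd (S m)) with false.
- apply (RInt_ext (V := C_R_CompleteNormedModule)); intros y _.
  replace (Z.of_nat (S m) - 1)%Z with (Z.of_nat m) by lia; rewrite X_of_nat.
  destruct m as [|[|p]]; [lia|now rewrite X_neg by lia|].
  now replace (Z.of_nat (S (S (S p))) - 3)%Z with (Z.of_nat p) by lia;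
    rewrite X_of_nat.
- symmetry; rewrite <- Nat.negb_even.
  replace (Nat.even (S m)) with true; [reflexivity|].
  symmetry; apply Nat.even_spec; exists (Z.to_nat k); lia.
Qed.

Definition is_solution (a : R) (P Q : R -> C) (lambda : C)
    (v1 v2 : R -> C) : Prop :=
  exists dv1 dv2 : R -> C,
    C1_seg a v1 dv1 /\ C1_seg a v2 dv2 /\
    (forall x, (- a < x < a)%R ->
       dv1 x = lambda * v1 x + P x * v2 x /\
       dv2 x = - lambda * v2 x - Q x * v1 x).

Definition is_eigenvalue (a : R) (P Q : R -> C) (lambda : C) : Prop :=
  (0 < Re lambda)%R /\
  exists v1 v2 : R -> C,
    is_solution a P Q lambda v1 v2 /\
    v1 (- a)%R = 1 /\ v2 (- a)%R = 0 /\ v1 a = 0.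

(* Main.v *)
Require Import Defs.
From Stdlib Require Import Reals ZArith Lra Lia.
From Coquelicot Require Import Coquelicot.

Local Open Scope C_scope.

(** The initial data v1(-a) = 1, v2(-a) = 0 determine one solution of the system,
    so lambda is an eigenvalue exactly when the first component of that solution
    vanishes at [a].  The proof writes this solution as power series in lambda.

    Eliminating v1 = - (v2' + lambda v2) / Q leaves the second-order equation
      (v2' / Q)' + P v2 = lambda (Q' / Q^2) v2 + lambda^2 v2 / Q,
    whose left-hand side annihilates v0.  With v2 = c v0 u and w = v0^2 u' / Q it
    becomes the first-order system
      u' = w Q / v0^2,
      w' = lambda u v0^2 Q' / Q^2 + lambda^2 u v0^2 / Q,
    with u(-a) = 0 and w(-a) = 1.  Solving it by powers of lambda gives
    u = sum lambda^k X^(2k+1) and w = sum lambda^k X^(2k): the recursion of the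
    X^(n) is the coefficientwise form of the system ([generating_functions]).
    The constant c = - v0(-a) makes v1(-a) = 1, and then v1(a) is the sum of the
    series in the theorem multiplied by the nonzero number
    v0(-a) / (Q(a) v0(a)) ([is_solution_of_generating_functions]).

    Convergence, uniform on the segment, follows from a weighted estimate: on
    functions bounded by a multiple of exp (L (x + a)), an integration from -a
    divides the bound by L, and L can be taken large in terms of lambda
    ([iterated_bound], [series_RInt_geom]).

    Uniqueness is an energy estimate.  Since P is the conjugate of Q, the
    derivative of |v1|^2 + |v2|^2 is 2 Re lambda (|v1|^2 - |v2|^2), so that
    exp (- 2 Re lambda x) (|v1|^2 + |v2|^2) does not increase
    ([is_solution_zero]). *)

(** * Limits of complex-valued functions *)

Lemma filterlim_C_Cmod {T : Type} {F : (T -> Prop) -> Prop} {FF : Filter F}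
    (f : T -> C) (l : C) :
  filterlim f F (locally l) <->
  (forall eps : R, (0 < eps)%R -> F (fun t => Cmod (f t - l) < eps)%R).
Proof.
rewrite (filterlim_locally_ball_norm (K := C_AbsRing) (U := C_NormedModule)).
split.
- intros H eps Heps; exact (H (mkposreal eps Heps)).
- intros H eps; exact (H eps (cond_pos eps)).
Qed.

Lemma filterlim_Cplus {T : Type} {F : (T -> Prop) -> Prop} {FF : Filter F}
    (f g : T -> C) (l m : C) :
  filterlim f F (locally l) -> filterlim g F (locally m) ->
  filterlim (fun t => f t + g t) F (locally (l + m)).
Proof.
intros Hf Hg.
apply (filterlim_comp_2 f g Cplus Hf Hg).
exact (filterlim_plus (K := C_AbsRing) (V := C_NormedModule) l m).
Qed.

(** The product is treated in the topology of the absolute value, where its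
    continuity is known, and transported to the product topology of [C]. *)
Lemma filterlim_Cmult {T : Type} {F : (T -> Prop) -> Prop} {FF : Filter F}
    (f g : T -> C) (l m : C) :
  filterlim f F (locally l) -> filterlim g F (locally m) ->
  filterlim (fun t => f t * g t) F (locally (l * m)).
Proof.
assert (abs_iff : forall (h : T -> C) (k : C),
  filterlim h F (locally (T := AbsRing_UniformSpace C_AbsRing) k) <->
  filterlim h F (locally k)).
{ intros h k; rewrite filterlim_C_Cmod.
  rewrite (filterlim_locally (U := AbsRing_UniformSpace C_AbsRing)).
  split.
  - intros H eps Heps; exact (H (mkposreal eps Heps)).
  - intros H eps; exact (H eps (cond_pos eps)). }
intros Hf Hg.
apply abs_iff; apply abs_iff in Hf; apply abs_iff in Hg.
apply (filterlim_comp_2 f g Cmult Hf Hg).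
exact (filterlim_mult (K := C_AbsRing) l m).
Qed.

Lemma filterlim_Cinv {T : Type} {F : (T -> Prop) -> Prop} {FF : Filter F}
    (f : T -> C) (l : C) :
  l <> 0 -> filterlim f F (locally l) ->
  filterlim (fun t => / f t) F (locally (/ l)).
Proof.
intros Hl Hf; apply filterlim_C_Cmod; intros eps Heps.
assert (Hl' := proj1 (Cmod_gt_0 l) Hl).
rewrite filterlim_C_Cmod in Hf.
assert (H1 := Hf (Cmod l / 2)%R ltac:(lra)).
assert (Hd : (0 < eps * (Cmod l * Cmod l / 2))%R).
{ apply Rmult_lt_0_compat; [lra|]. assert (0 < Cmod l * Cmod l)%R by nra; lra. }
assert (H2 := Hf _ Hd).
generalize (filter_and _ _ H1 H2); apply filter_imp; intros t [A B].
(* |f t| >= |l|/2 near the limit, so 1/(f t) is bounded by 2/|l|. *)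
assert (Hft : (Cmod l / 2 < Cmod (f t))%R).
{ assert (Htri := Cmod_triangle (f t) (- (f t - l))).
  rewrite Cmod_opp in Htri.
  replace (f t + - (f t - l)) with l in Htri by ring. lra. }
assert (f t <> 0) by (apply Cmod_gt_0; lra).
replace (/ f t - / l) with (- (f t - l) / (f t * l)) by (field; auto).
rewrite Cmod_div by (apply Cmult_neq_0; auto).
rewrite Cmod_opp, Cmod_mult.
apply Rmult_lt_reg_r with (Cmod (f t) * Cmod l)%R; [nra|].
unfold Rdiv; rewrite Rmult_assoc, Rinv_l by nra.
apply Rlt_le_trans with (eps * (Cmod l * Cmod l / 2))%R; [lra|].
apply Rmult_le_compat_l; [lra|]. nra.
Qed.

Lemma filterlim_Cconj {T : Type} {F : (T -> Prop) -> Prop} {FF : Filter F}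
    (f : T -> C) (l : C) :
  filterlim f F (locally l) ->
  filterlim (fun t => Cconj (f t)) F (locally (Cconj l)).
Proof.
rewrite !filterlim_C_Cmod; intros Hf eps Heps.
generalize (Hf eps Heps); apply filter_imp; intros t.
rewrite <- (Cmod_conj (f t - l)).
replace (Cconj (f t - l)) with (Cconj (f t) - Cconj l); [auto|].
apply injective_projections; simpl; ring.
Qed.

(** * Continuity on a segment *)

#[local] Instance within_segment_filter (a x : R) :
  Filter (within (segment a) (locally x)).
Proof. apply within_filter, locally_filter. Qed.

Lemma continuous_on_Cconst (a : R) (c : C) :
  continuous_on (segment a) (fun _ : R => c).
Proof. intros x _; apply filterlim_const. Qed.

Lemma continuous_on_Cplus (a : R) (f g : R -> C) :
  continuous_on (segment a) f -> continuous_on (segment a) g ->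
  continuous_on (segment a) (fun x => f x + g x).
Proof. intros Hf Hg x Hx; apply filterlim_Cplus; auto. Qed.

Lemma continuous_on_Cmult (a : R) (f g : R -> C) :
  continuous_on (segment a) f -> continuous_on (segment a) g ->
  continuous_on (segment a) (fun x => f x * g x).
Proof. intros Hf Hg x Hx; apply filterlim_Cmult; auto. Qed.

Lemma continuous_on_C_ext (a : R) (f g : R -> C) :
  (forall x, segment a x -> f x = g x) ->
  continuous_on (segment a) f -> continuous_on (segment a) g.
Proof.
intros E Hf x Hx; rewrite <- (E x Hx).
exact (filterlim_within_ext (segment a) f g E (Hf x Hx)).
Qed.

(** * Derivatives relative to a segment *)

(** Caratheodory's characterization of the relative derivative: [f] has
    derivative [l] at [x] when its slope function has limit [l]. *)
Lemma is_derive_seg_slope (a : R) (f : R -> C) (x : R) (l : C) :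
  segment a x ->
  (is_derive_seg a f x l <->
   exists phi : R -> C,
     filterlim phi (within (segment a) (locally x)) (locally l) /\
     forall y : R, segment a y -> f y = f x + (y - x) * phi y).
Proof.
intros Hx; split.
- intros [_ H].
  exists (fun y => if Req_EM_T y x then l else (f y - f x) / (y - x)); split.
  + apply filterlim_C_Cmod; intros eps Heps.
    assert (Hlim : is_filter_lim (within (segment a) (locally x)) x).
    { intros P HP; apply filter_le_within; exact HP. }
    assert (Heps2 : (0 < eps / 2)%R) by lra.
    generalize (H x Hlim (mkposreal _ Heps2)); apply filter_imp.
    intros y Hy.
    destruct (Req_EM_T y x) as [->|Hne].
    * replace (l - l) with (RtoC 0) by ring; rewrite Cmod_0; lra.
    * assert (Hyx : (y - x : C) <> 0).
      { intros E0; apply Hne; apply RtoC_inj.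
        replace (RtoC y) with ((y - x) + x : C) by ring; rewrite E0; ring. }
      assert (Hp := proj1 (Cmod_gt_0 _) Hyx).
      replace ((f y - f x) / (y - x) - l)
        with ((f y - f x - (y - x) * l) / (y - x)) by (field; auto).
      rewrite Cmod_div by auto.
      assert (Hy' : (Cmod (f y - f x - (y - x) * l) <= eps / 2 * Cmod (y - x))%R).
      { rewrite <- RtoC_minus in *. rewrite Cmod_R.
        rewrite <- scal_R_Cmult, Cmod_norm. exact Hy. }
      apply Rmult_lt_reg_r with (Cmod (y - x)); [auto|].
      unfold Rdiv at 1; rewrite Rmult_assoc, Rinv_l by lra. nra.
  + intros y _; destruct (Req_EM_T y x) as [->|Hne]; [ring|].
    field. intros E0; apply Hne; apply RtoC_inj.
    replace (RtoC y) with ((y - x) + x : C) by ring; rewrite E0; ring.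
- intros [phi [Hphi E]]; split.
  { apply (is_linear_scal_l (K := R_AbsRing) (V := C_R_NormedModule) l). }
  intros x' Hx' eps.
  assert (x' = x) as ->.
  { apply (eq_close (K := R_AbsRing) (V := R_NormedModule)); intros e.
    assert (H := locally_singleton _ _ (Hx' _ (locally_ball x' e)) Hx).
    exact H. }
  rewrite filterlim_C_Cmod in Hphi.
  generalize (Hphi eps (cond_pos eps)); unfold within; apply filter_imp.
  intros y Hy Sy; specialize (Hy Sy).
  assert (G : (Cmod (f y - f x - (y - x) * l) <= eps * Cmod (y - x))%R).
  { rewrite (E y Sy).
    replace (f x + (y - x) * phi y - f x - (y - x) * l)
      with ((phi y - l) * (y - x)) by ring.
    rewrite Cmod_mult; apply Rmult_le_compat_r; [apply Cmod_ge_0|lra]. }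
  rewrite <- RtoC_minus in G; rewrite Cmod_R in G.
  rewrite <- scal_R_Cmult, Cmod_norm in G; exact G.
Qed.

Lemma is_derive_seg_continuous (a : R) (f : R -> C) (x : R) (l : C) :
  segment a x -> is_derive_seg a f x l ->
  filterlim f (within (segment a) (locally x)) (locally (f x)).
Proof.
intros Hx H; apply is_derive_seg_slope in H; [|exact Hx].
destruct H as [phi [Hphi E]].
apply (filterlim_within_ext (segment a) (fun y => f x + (y - x) * phi y)).
{ intros y Hy; symmetry; auto. }
replace (f x) with (f x + 0 * l) at 1 by ring.
apply filterlim_Cplus; [apply filterlim_const|].
apply filterlim_Cmult; [|exact Hphi].
apply filterlim_C_Cmod; intros eps Heps.
apply filter_le_within; exists (mkposreal eps Heps); intros y Hy.
replace (y - x - 0) with (RtoC (y - x)) by (rewrite RtoC_minus; ring).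
rewrite Cmod_R; exact Hy.
Qed.

Lemma has_derivative_continuous_on (a : R) (f df : R -> C) :
  has_derivative a f df -> continuous_on (segment a) f.
Proof. intros H x Hx; eapply is_derive_seg_continuous; auto. Qed.

Lemma is_derive_seg_const (a : R) (c : C) (x : R) :
  segment a x -> is_derive_seg a (fun _ => c) x 0.
Proof.
intros Hx; apply is_derive_seg_slope; [exact Hx|].
exists (fun _ => 0); split; [apply filterlim_const|intros y _; ring].
Qed.

Lemma is_derive_seg_plus (a : R) (f g : R -> C) (x : R) (l m : C) :
  segment a x -> is_derive_seg a f x l -> is_derive_seg a g x m ->
  is_derive_seg a (fun y => f y + g y) x (l + m).
Proof.
intros Hx Hf Hg.
apply is_derive_seg_slope in Hf; [|exact Hx].
apply is_derive_seg_slope in Hg; [|exact Hx].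
destruct Hf as [phi [Hphi Ef]]; destruct Hg as [psi [Hpsi Eg]].
apply is_derive_seg_slope; [exact Hx|].
exists (fun y => phi y + psi y); split.
- apply filterlim_Cplus; auto.
- intros y Hy; rewrite (Ef y Hy), (Eg y Hy); ring.
Qed.

Lemma is_derive_seg_mult (a : R) (f g : R -> C) (x : R) (l m : C) :
  segment a x -> is_derive_seg a f x l -> is_derive_seg a g x m ->
  is_derive_seg a (fun y => f y * g y) x (l * g x + f x * m).
Proof.
intros Hx Hf Hg.
assert (Cg := is_derive_seg_continuous _ _ _ _ Hx Hg).
apply is_derive_seg_slope in Hf; [|exact Hx].
apply is_derive_seg_slope in Hg; [|exact Hx].
destruct Hf as [phi [Hphi Ef]]; destruct Hg as [psi [Hpsi Eg]].
apply is_derive_seg_slope; [exact Hx|].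
exists (fun y => phi y * g y + f x * psi y); split.
- apply filterlim_Cplus; apply filterlim_Cmult; auto; apply filterlim_const.
- intros y Hy; rewrite (Ef y Hy), (Eg y Hy); ring.
Qed.

Lemma is_derive_seg_inv (a : R) (f : R -> C) (x : R) (l : C) :
  segment a x -> (forall y, segment a y -> f y <> 0) ->
  is_derive_seg a f x l ->
  is_derive_seg a (fun y => / f y) x (- l / f x ^ 2).
Proof.
intros Hx Hnz Hf.
assert (Cf := is_derive_seg_continuous _ _ _ _ Hx Hf).
assert (Hfx := Hnz x Hx).
apply is_derive_seg_slope in Hf; [|exact Hx].
destruct Hf as [phi [Hphi Ef]].
apply is_derive_seg_slope; [exact Hx|].
exists (fun y => - (1) * phi y * (/ f y * / f x)); split.
- replace (- l / f x ^ 2) with (- (1) * l * (/ f x * / f x)) by (field; auto).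
  apply filterlim_Cmult.
  + apply filterlim_Cmult; [apply filterlim_const|exact Hphi].
  + apply filterlim_Cmult; [|apply filterlim_const].
    apply filterlim_Cinv; auto.
- intros y Hy; assert (Hfy := Hnz y Hy).
  replace ((y - x) * (- (1) * phi y * (/ f y * / f x)))
    with (- ((y - x) * phi y) * (/ f y * / f x)) by ring.
  replace ((y - x) * phi y) with (f y - f x) by (rewrite (Ef y Hy) at 1; ring).
  field; auto.
Qed.

Lemma is_derive_seg_ext (a : R) (f g : R -> C) (x : R) (l : C) :
  segment a x -> (forall y, segment a y -> f y = g y) ->
  is_derive_seg a f x l -> is_derive_seg a g x l.
Proof.
intros Hx E Hf; apply is_derive_seg_slope in Hf; [|exact Hx].
destruct Hf as [phi [Hphi Ef]].
apply is_derive_seg_slope; [exact Hx|].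
exists phi; split; [exact Hphi|].
intros y Hy; rewrite <- (E y Hy), <- (E x Hx); auto.
Qed.

(** At an interior point the relative derivative is the ordinary one. *)
Lemma is_derive_seg_interior (a : R) (f : R -> C) (x : R) (l : C) :
  (- a < x < a)%R -> is_derive_seg a f x l ->
  is_derive (V := C_R_NormedModule) f x l.
Proof.
intros Hx [Hl H]; split; [exact Hl|].
intros x' Hx' eps.
assert (x = x') as <- by
  (apply (is_filter_lim_locally_unique (V := R_NormedModule)); exact Hx').
assert (Hlim : is_filter_lim (within (segment a) (locally x)) x).
{ intros P HP; apply filter_le_within; exact HP. }
assert (Hd := H x Hlim eps); unfold within in Hd.
generalize (filter_and _ _ Hd
  (open_and _ _ (open_gt (- a)%R) (open_lt a) x Hx)).
apply filter_imp; intros y [Hy1 Hy2]; apply Hy1; unfold segment; lra.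
Qed.

Lemma is_derive_is_derive_seg (a : R) (f : R -> C) (x : R) (l : C) :
  segment a x ->
  is_derive (V := C_R_NormedModule) f x l -> is_derive_seg a f x l.
Proof.
intros Hx H.
assert (Hlim : is_filter_lim (within (segment a) (locally x)) x).
{ intros P HP; apply filter_le_within; exact HP. }
refine (filterdiff_locally (F := within (segment a) (locally x)) f x _ Hlim H).
constructor; [|apply within_segment_filter].
intros P HP; exists x; exact (locally_singleton _ _ HP Hx).
Qed.

(** * Integrals of functions continuous on a segment *)

(** The projection of the line onto the segment.  Composition with it extends a
    function continuous on the segment to one continuous on the whole line, to which
    two-sided results on integrals and derivatives apply. *)
Definition clamp (a x : R) : R := Rmax (- a) (Rmin a x).

Lemma clamp_segment (a x : R) : (0 < a)%R -> segment a (clamp a x).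
Proof.
intros Ha; unfold segment, clamp; split; [apply Rmax_l|].
apply Rmax_lub; [lra|apply Rmin_l].
Qed.

Lemma clamp_id (a x : R) : segment a x -> clamp a x = x.
Proof.
intros [H1 H2]; unfold clamp; rewrite Rmin_right by lra; now rewrite Rmax_right by lra.
Qed.

Lemma clamp_dist (a x y : R) : (Rabs (clamp a y - clamp a x) <= Rabs (y - x))%R.
Proof.
unfold clamp, Rmax, Rmin.
repeat (destruct (Rle_dec _ _)); unfold Rabs; repeat destruct (Rcase_abs _); lra.
Qed.

Lemma continuous_clamp (a : R) (f : R -> C) (x : R) :
  (0 < a)%R -> continuous_on (segment a) f ->
  filterlim (fun y => f (clamp a y)) (locally x) (locally (f (clamp a x))).
Proof.
intros Ha Hf P HP.
destruct (Hf _ (clamp_segment a x Ha) P HP) as [e He].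
exists e; intros y Hy; apply He; [|apply clamp_segment; exact Ha].
apply Rle_lt_trans with (2 := Hy); apply clamp_dist.
Qed.

Lemma ex_RInt_segment (a : R) (f : R -> C) (x : R) :
  (0 < a)%R -> continuous_on (segment a) f -> segment a x ->
  ex_RInt (V := C_R_CompleteNormedModule) f (- a)%R x.
Proof.
intros Ha Hf Hx.
apply (ex_RInt_ext (V := C_R_CompleteNormedModule) (fun y => f (clamp a y))).
- unfold segment in Hx; rewrite Rmin_left, Rmax_right by lra; intros y Hy.
  rewrite clamp_id; [reflexivity|unfold segment; lra].
- apply (ex_RInt_continuous (V := C_R_CompleteNormedModule)); intros y _.
  apply (continuous_clamp a f y Ha Hf).
Qed.

(** Fundamental theorem of calculus on the closed segment. *)
Lemma has_derivative_RInt (a : R) (f : R -> C) :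
  (0 < a)%R -> continuous_on (segment a) f ->
  has_derivative a
    (fun x => RInt (V := C_R_CompleteNormedModule) f (- a)%R x) f.
Proof.
intros Ha Hf x Hx.
apply (is_derive_seg_ext a
  (fun x => RInt (V := C_R_CompleteNormedModule) (fun y => f (clamp a y)) (- a)%R x)).
- exact Hx.
- intros y Hy; apply (RInt_ext (V := C_R_CompleteNormedModule)).
  unfold segment in Hy; rewrite Rmin_left, Rmax_right by lra; intros z Hz.
  rewrite clamp_id; [reflexivity|unfold segment; lra].
- apply is_derive_is_derive_seg; [exact Hx|].
  rewrite <- (clamp_id a x Hx) at 2.
  apply (is_derive_RInt (V := C_R_NormedModule) (fun y => f (clamp a y)) _ (- a)%R).
  + apply filter_forall; intros y.
    apply (RInt_correct (V := C_R_CompleteNormedModule)).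
    apply (ex_RInt_continuous (V := C_R_CompleteNormedModule)); intros z _.
    apply (continuous_clamp a f z Ha Hf).
  + apply (continuous_clamp a f x Ha Hf).
Qed.

Lemma bounded_segment (a : R) (f : R -> C) :
  (0 < a)%R -> continuous_on (segment a) f ->
  exists M : R, forall x, segment a x -> (Cmod (f x) <= M)%R.
Proof.
intros Ha Hf.
destruct (bounded_continuity (V := C_R_NormedModule) (fun y => f (clamp a y))
  (- a)%R a) as [M HM].
{ intros x _; apply (continuous_clamp a f x Ha Hf). }
exists M; intros x Hx; rewrite <- (clamp_id a x Hx) at 1.
rewrite Cmod_norm; left; apply HM; exact Hx.
Qed.

Lemma Cmod_RInt_le_const (a : R) (f : R -> C) (x K : R) :
  (0 < a)%R -> continuous_on (segment a) f -> segment a x ->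
  (forall y, segment a y -> (Cmod (f y) <= K)%R) ->
  (Cmod (RInt (V := C_R_CompleteNormedModule) f (- a)%R x) <= (x + a) * K)%R.
Proof.
intros Ha Hf Hx HK; rewrite Cmod_norm.
replace (x + a)%R with (x - - a)%R by ring.
apply (norm_RInt_le_const (V := C_R_NormedModule) f (- a)%R x).
- apply Hx.
- unfold segment in Hx; intros y Hy.
  assert (G := HK y ltac:(unfold segment; lra)); rewrite Cmod_norm in G; exact G.
- apply (RInt_correct (V := C_R_CompleteNormedModule)).
  apply ex_RInt_segment; auto.
Qed.

(** Integration from -a divides a bound of the form K exp (L (x + a)) by [L];
    taking [L] large makes the iterated integrals decrease geometrically. *)
Lemma Cmod_RInt_le_exp (a : R) (f : R -> C) (x K L : R) :
  (0 < a)%R -> (0 < L)%R -> (0 <= K)%R ->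
  continuous_on (segment a) f -> segment a x ->
  (forall y, segment a y -> (Cmod (f y) <= K * exp (L * (y + a)))%R) ->
  (Cmod (RInt (V := C_R_CompleteNormedModule) f (- a)%R x)
   <= K / L * exp (L * (x + a)))%R.
Proof.
intros Ha HL HK Hf Hx Hb.
apply Rle_trans with (K / L * exp (L * (x + a)) - K / L * exp (L * (- a + a)))%R.
- rewrite Cmod_norm.
  apply (norm_RInt_le (V := C_R_NormedModule) f
    (fun y => K * exp (L * (y + a)))%R (- a)%R x).
  + apply Hx.
  + unfold segment in Hx; intros y Hy.
    assert (G := Hb y ltac:(unfold segment; lra)); rewrite Cmod_norm in G; exact G.
  + apply (RInt_correct (V := C_R_CompleteNormedModule)).
    apply ex_RInt_segment; auto.
  + apply (is_RInt_derive (fun y => K / L * exp (L * (y + a)))%R).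
    * intros y _; auto_derive; [exact I|field; lra].
    * intros y _; apply (ex_derive_continuous (fun y => K * exp (L * (y + a)))%R).
      auto_derive; exact I.
- assert (0 <= K / L * exp (L * (- a + a)))%R; [|lra].
  apply Rmult_le_pos; [|left; apply exp_pos].
  apply Rmult_le_pos; [exact HK|left; apply Rinv_0_lt_compat; exact HL].
Qed.

(** * Series of functions bounded by a geometric series *)

Lemma is_series_C_unique (s : nat -> C) (l m : C) :
  is_series (K := C_AbsRing) (V := C_NormedModule) s l ->
  is_series (K := C_AbsRing) (V := C_NormedModule) s m -> l = m.
Proof.
apply (filterlim_locally_unique (V := C_NormedModule) (F := eventually)).
Qed.

Lemma is_series_C_ext (s t : nat -> C) (l m : C) :
  (forall k, s k = t k) -> l = m ->
  is_series (K := C_AbsRing) (V := C_NormedModule) s l ->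
  is_series (K := C_AbsRing) (V := C_NormedModule) t m.
Proof. intros E <-; apply (is_series_ext (V := C_NormedModule)); exact E. Qed.

Lemma sum_n_C_Sn (s : nat -> C) (N : nat) :
  sum_n (G := C_NormedModule) s (S N) = sum_n (G := C_NormedModule) s N + s (S N).
Proof. exact (sum_Sn (G := C_NormedModule) s N). Qed.

Lemma half_pow_pos (n : nat) : (0 < (1 / 2) ^ n)%R.
Proof. apply pow_lt; lra. Qed.

Lemma half_pow_small (K eps : R) :
  (0 < eps)%R -> eventually (fun N => K * (1 / 2) ^ N < eps)%R.
Proof.
intros Heps.
destruct (pow_lt_1_zero (1 / 2) ltac:(rewrite Rabs_pos_eq; lra)
  (eps / (Rabs K + 1))) as [N HN].
{ apply Rdiv_lt_0_compat; [lra|]. assert (H := Rabs_pos K); lra. }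
exists N; intros n Hn; specialize (HN n Hn).
assert (Hp := half_pow_pos n).
assert (HK := Rabs_pos K); assert (HK' := Rle_abs K).
rewrite Rabs_pos_eq in HN by lra.
apply Rlt_le_trans with ((Rabs K + 1) * (eps / (Rabs K + 1)))%R.
- apply Rle_lt_trans with ((Rabs K + 1) * (1 / 2) ^ n)%R; [nra|].
  apply Rmult_lt_compat_l; lra.
- right; field; lra.
Qed.

Lemma is_series_C_geom_tail (s : nat -> C) (l : C) (K : R) :
  (forall N, Cmod (sum_n (G := C_NormedModule) s N - l) <= K * (1 / 2) ^ N)%R ->
  is_series (K := C_AbsRing) (V := C_NormedModule) s l.
Proof.
intros H.
apply (proj2 (filterlim_C_Cmod (F := eventually) (sum_n (G := C_NormedModule) s) l)).
intros eps Heps; generalize (half_pow_small K eps Heps).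
apply filter_imp; intros N HN; specialize (H N); lra.
Qed.

Lemma series_C_geom_tail (s : nat -> C) (K : R) :
  (forall k, Cmod (s k) <= K * (1 / 2) ^ k)%R ->
  exists l : C,
    is_series (K := C_AbsRing) (V := C_NormedModule) s l /\
    forall N, (Cmod (sum_n (G := C_NormedModule) s N - l) <= K * (1 / 2) ^ N)%R.
Proof.
intros Hs.
assert (Hex : ex_series (V := C_CompleteNormedModule) s).
{ apply (ex_series_le (V := C_CompleteNormedModule) s
    (fun k => scal K ((1 / 2) ^ k)%R)).
  - intros k; exact (Hs k).
  - apply (ex_series_scal_l K (fun k => ((1 / 2) ^ k)%R)).
    apply ex_series_geom; rewrite Rabs_pos_eq; lra. }
destruct Hex as [l Hl]; exists l; split; [exact Hl|]; intros N.
(* The block of terms N+1, ..., N+p is at most K (1/2)^N (1 - (1/2)^p). *)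
assert (Hc : forall p, (Cmod (sum_n (G := C_NormedModule) s (N + p)
   - sum_n (G := C_NormedModule) s N) <= K * (1 / 2) ^ N * (1 - (1 / 2) ^ p))%R).
{ induction p as [|p IH].
  - rewrite Nat.add_0_r; simpl pow.
    match goal with |- (Cmod (?z - ?z) <= _)%R =>
      replace (z - z) with (RtoC 0) by ring end.
    rewrite Cmod_0; lra.
  - rewrite Nat.add_succ_r, sum_n_C_Sn.
    assert (Ht := Cmod_triangle
      (sum_n (G := C_NormedModule) s (N + p) - sum_n (G := C_NormedModule) s N)
      (s (S (N + p)))).
    match goal with H : (Cmod ?z <= _)%R |- (Cmod ?z' <= _)%R =>
      match z with context [s (S (N + p))] =>
      replace z' with z by ring end end.
    specialize (Hs (S (N + p))).
    replace ((1 / 2) ^ S (N + p))%R with ((1/2) ^ N * ((1 / 2) ^ p * (1/2)))%R in Hs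
      by (rewrite <- Nat.add_succ_r, pow_add; simpl; ring).
    simpl pow; simpl pow in IH; nra. }
apply le_epsilon; intros eps Heps.
assert (Hl' := proj1 (filterlim_C_Cmod (F := eventually)
  (sum_n (G := C_NormedModule) s) l) Hl eps Heps).
destruct Hl' as [p Hp]; specialize (Hp (N + p)%nat ltac:(lia)); specialize (Hc p).
assert (Ht := Cmod_triangle
  (- (sum_n (G := C_NormedModule) s (N + p) - sum_n (G := C_NormedModule) s N))
  (sum_n (G := C_NormedModule) s (N + p) - l)).
rewrite Cmod_opp in Ht.
match goal with H : (Cmod ?z <= _ + _)%R |- (Cmod ?z' <= _)%R =>
  replace z' with z by ring end.
assert (0 <= K * (1 / 2) ^ N)%R.
{ apply Rle_trans with (2 := Hs N); apply Cmod_ge_0. }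
assert (Hq := half_pow_pos p); nra.
Qed.

Lemma continuous_on_sum_n (a : R) (f : nat -> R -> C) (N : nat) :
  (forall k, continuous_on (segment a) (f k)) ->
  continuous_on (segment a) (fun x => sum_n (G := C_NormedModule) (fun k => f k x) N).
Proof.
intros Hf; induction N as [|N IH].
- apply (continuous_on_C_ext a (f 0%nat)); [|apply Hf].
  intros x _; symmetry; apply (sum_O (G := C_NormedModule)).
- apply (continuous_on_C_ext a (fun x =>
    sum_n (G := C_NormedModule) (fun k => f k x) N + f (S N) x)).
  + intros x _; symmetry; apply sum_n_C_Sn.
  + apply continuous_on_Cplus; [exact IH|apply Hf].
Qed.

Lemma continuous_on_uniform_limit (a : R) (S : nat -> R -> C) (g : R -> C) (K : R) :
  (forall N, continuous_on (segment a) (S N)) ->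
  (forall N x, segment a x -> Cmod (S N x - g x) <= K * (1 / 2) ^ N)%R ->
  continuous_on (segment a) g.
Proof.
intros HS Hg x Hx; apply filterlim_C_Cmod; intros eps Heps.
destruct (half_pow_small K (eps / 3) ltac:(lra)) as [N HN].
specialize (HN N (le_n N)).
assert (Hc := proj1 (filterlim_C_Cmod _ _) (HS N x Hx) (eps / 3)%R ltac:(lra)).
revert Hc; unfold within; apply filter_imp; intros y Hc Hy; specialize (Hc Hy).
assert (H1 := Hg N y Hy); assert (H2 := Hg N x Hx).
replace (g y - g x)
  with (- (S N y - g y) + ((S N y - S N x) + (S N x - g x))) by ring.
assert (T1 := Cmod_triangle (- (S N y - g y)) ((S N y - S N x) + (S N x - g x))).
assert (T2 := Cmod_triangle (S N y - S N x) (S N x - g x)).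
rewrite Cmod_opp in T1; lra.
Qed.

Lemma RInt_Cminus (a : R) (f g : R -> C) (x : R) :
  (0 < a)%R -> continuous_on (segment a) f -> continuous_on (segment a) g ->
  segment a x ->
  RInt (V := C_R_CompleteNormedModule) (fun y => f y - g y) (- a)%R x =
  RInt (V := C_R_CompleteNormedModule) f (- a)%R x
  - RInt (V := C_R_CompleteNormedModule) g (- a)%R x.
Proof.
intros Ha Hf Hg Hx.
apply (RInt_minus (V := C_R_CompleteNormedModule)); apply ex_RInt_segment; auto.
Qed.

Lemma RInt_Cplus (a : R) (f g : R -> C) (x : R) :
  (0 < a)%R -> continuous_on (segment a) f -> continuous_on (segment a) g ->
  segment a x ->
  RInt (V := C_R_CompleteNormedModule) (fun y => f y + g y) (- a)%R x =
  RInt (V := C_R_CompleteNormedModule) f (- a)%R x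
  + RInt (V := C_R_CompleteNormedModule) g (- a)%R x.
Proof.
intros Ha Hf Hg Hx.
apply (RInt_plus (V := C_R_CompleteNormedModule)); apply ex_RInt_segment; auto.
Qed.

Lemma RInt_Csum_n (a : R) (f : nat -> R -> C) (x : R) (N : nat) :
  (0 < a)%R -> (forall k, continuous_on (segment a) (f k)) -> segment a x ->
  RInt (V := C_R_CompleteNormedModule)
    (fun y => sum_n (G := C_NormedModule) (fun k => f k y) N) (- a)%R x =
  sum_n (G := C_NormedModule)
    (fun k => RInt (V := C_R_CompleteNormedModule) (f k) (- a)%R x) N.
Proof.
intros Ha Hf Hx; induction N as [|N IH].
- rewrite (sum_O (G := C_NormedModule)).
  apply (RInt_ext (V := C_R_CompleteNormedModule)); intros y _.
  apply (sum_O (G := C_NormedModule)).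
- rewrite sum_n_C_Sn, <- IH, <- RInt_Cplus; auto.
  + apply (RInt_ext (V := C_R_CompleteNormedModule)); intros y _.
    apply sum_n_C_Sn.
  + apply continuous_on_sum_n; exact Hf.
Qed.

Lemma RInt_Cscal (a : R) (c : C) (f : R -> C) (x : R) :
  (0 < a)%R -> continuous_on (segment a) f -> segment a x ->
  RInt (V := C_R_CompleteNormedModule) (fun y => c * f y) (- a)%R x =
  c * RInt (V := C_R_CompleteNormedModule) f (- a)%R x.
Proof.
intros Ha Hf Hx.
apply (is_RInt_unique (V := C_R_CompleteNormedModule)).
assert (H := RInt_correct (V := C_R_CompleteNormedModule) f (- a)%R x
  (ex_RInt_segment a f x Ha Hf Hx)).
assert (H1 := is_RInt_fct_extend_fst (U := R_NormedModule) (V := R_NormedModule)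
  _ _ _ _ H).
assert (H2 := is_RInt_fct_extend_snd (U := R_NormedModule) (V := R_NormedModule)
  _ _ _ _ H).
destruct c as [c1 c2].
apply (is_RInt_fct_extend_pair (U := R_NormedModule) (V := R_NormedModule)).
- exact (is_RInt_minus (V := R_NormedModule) _ _ _ _ _ _
    (is_RInt_scal _ _ _ c1 _ H1) (is_RInt_scal _ _ _ c2 _ H2)).
- exact (is_RInt_plus (V := R_NormedModule) _ _ _ _ _ _
    (is_RInt_scal _ _ _ c1 _ H2) (is_RInt_scal _ _ _ c2 _ H1)).
Qed.

(** A series of continuous functions dominated by a geometric series has a
    continuous sum and may be integrated term by term. *)
Lemma series_RInt_geom (a : R) (f : nat -> R -> C) (K : R) :
  (0 < a)%R -> (forall k, continuous_on (segment a) (f k)) ->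
  (forall k x, segment a x -> Cmod (f k x) <= K * (1 / 2) ^ k)%R ->
  exists g : R -> C, continuous_on (segment a) g /\
  forall x, segment a x ->
    is_series (K := C_AbsRing) (V := C_NormedModule) (fun k => f k x) (g x) /\
    is_series (K := C_AbsRing) (V := C_NormedModule)
      (fun k => RInt (V := C_R_CompleteNormedModule) (f k) (- a)%R x)
      (RInt (V := C_R_CompleteNormedModule) g (- a)%R x).
Proof.
intros Ha Hf HK.
(* iota selects the sum of the series; it is meaningful where the series
   converges, in particular on the segment. *)
pose (g := fun x => iota (T := C_CompleteNormedModule) (fun l =>
  is_series (K := C_AbsRing) (V := C_NormedModule) (fun k => f k x) l)).
assert (Hg : forall x, segment a x ->
  is_series (K := C_AbsRing) (V := C_NormedModule) (fun k => f k x) (g x) /\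
  forall N, (Cmod (sum_n (G := C_NormedModule) (fun k => f k x) N - g x)
             <= K * (1 / 2) ^ N)%R).
{ intros x Hx.
  destruct (series_C_geom_tail (fun k => f k x) K (fun k => HK k x Hx)) as [l [Hl1 Hl2]].
  replace (g x) with l; [auto|].
  symmetry; apply (iota_unique (V := C_CompleteNormedModule)); [|exact Hl1].
  intros m Hm; exact (is_series_C_unique _ _ _ Hm Hl1). }
assert (Hcg : continuous_on (segment a) g).
{ apply (continuous_on_uniform_limit a
    (fun N x => sum_n (G := C_NormedModule) (fun k => f k x) N) g K).
  - intros N; apply continuous_on_sum_n; exact Hf.
  - intros N x Hx; apply Hg; exact Hx. }
exists g; split; [exact Hcg|]; intros x Hx; split; [apply Hg; exact Hx|].
apply is_series_C_geom_tail with (K := ((x + a) * K)%R); intros N.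
rewrite <- RInt_Csum_n by auto.
rewrite <- RInt_Cminus; auto; [|apply continuous_on_sum_n; exact Hf].
rewrite Rmult_assoc; apply Cmod_RInt_le_const; auto.
- apply (continuous_on_C_ext a (fun y =>
    sum_n (G := C_NormedModule) (fun k => f k y) N + - (1) * g y)).
  { intros y _; ring. }
  apply continuous_on_Cplus; [apply continuous_on_sum_n; exact Hf|].
  apply continuous_on_Cmult; [apply continuous_on_Cconst|exact Hcg].
- intros y Hy; apply Hg; exact Hy.
Qed.

(** * The iterated integrals and their generating functions *)

(** Ring equalities in [C] stated with the operations of [C] as a module over
    itself. *)
Ltac C_module_ring :=
  match goal with |- @eq _ ?l ?r => change (@eq C l r) end;
  change (@plus C_NormedModule) with Cplus;
  change (@opp C_NormedModule) with Copp;
  change (@scal C_AbsRing C_NormedModule) with Cmult;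
  simpl; ring.

(** An abstract form of the recursion: [A k], [B k] and [B' k] stand for the
    functions X of index 2k, 2k+1 and 2k-1, and [q], [r], [s] for the coefficients
    Q / v0^2, v0^2 Q' / Q^2 and v0^2 / Q. *)
Section Iterated.

Variables (a : R) (q r s : R -> C) (A B B' : nat -> R -> C).
Hypothesis Ha : (0 < a)%R.
Hypothesis Hq : continuous_on (segment a) q.
Hypothesis Hr : continuous_on (segment a) r.
Hypothesis Hs : continuous_on (segment a) s.
Hypothesis HA0 : forall x, A 0%nat x = 1.
Hypothesis HB'0 : forall x, B' 0%nat x = 0.
Hypothesis HB'S : forall k x, B' (S k) x = B k x.
Hypothesis HB : forall k x, B k x =
  RInt (V := C_R_CompleteNormedModule) (fun y => A k y * q y) (- a)%R x.
Hypothesis HA : forall k x, A (S k) x =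
  RInt (V := C_R_CompleteNormedModule)
    (fun y => B k y * r y + B' k y * s y) (- a)%R x.

Lemma iterated_continuous (k : nat) :
  continuous_on (segment a) (A k) /\ continuous_on (segment a) (B k) /\
  continuous_on (segment a) (B' k).
Proof.
assert (step : forall n, continuous_on (segment a) (A n) ->
                         continuous_on (segment a) (B n)).
{ intros n HAn.
  apply (continuous_on_C_ext a (fun x => RInt (V := C_R_CompleteNormedModule)
    (fun y => A n y * q y) (- a)%R x)).
  { intros x _; symmetry; apply HB. }
  eapply has_derivative_continuous_on; apply has_derivative_RInt; [exact Ha|].
  apply continuous_on_Cmult; auto. }
induction k as [|k [IHA [IHB IHB']]].
- assert (H0 : continuous_on (segment a) (A 0%nat)).
  { apply (continuous_on_C_ext a (fun _ => 1)); [auto|apply continuous_on_Cconst]. }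
  split; [exact H0|split; [auto|]].
  apply (continuous_on_C_ext a (fun _ => 0)); [auto|apply continuous_on_Cconst].
- assert (H1 : continuous_on (segment a) (A (S k))).
  { apply (continuous_on_C_ext a (fun x => RInt (V := C_R_CompleteNormedModule)
      (fun y => B k y * r y + B' k y * s y) (- a)%R x)).
    { intros x _; symmetry; apply HA. }
    eapply has_derivative_continuous_on; apply has_derivative_RInt; [exact Ha|].
    apply continuous_on_Cplus; apply continuous_on_Cmult; auto. }
  split; [exact H1|split; [auto|]].
  apply (continuous_on_C_ext a (B k)); auto.
Qed.

(** With the weight exp (2 M (x + a) / theta), multiplication by a coefficient
    bounded by [M] followed by integration gains a factor theta / 2. *)
Lemma iterated_bound (M theta : R) :
  (0 < M)%R -> (0 < theta <= 1)%R ->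
  (forall x, segment a x -> Cmod (q x) <= M /\ Cmod (r x) <= M /\ Cmod (s x) <= M)%R ->
  forall k x, segment a x ->
  (Cmod (A k x) <= theta ^ k * exp (2 * M / theta * (x + a)) /\
   Cmod (B k x) <= theta ^ S k / 2 * exp (2 * M / theta * (x + a)) /\
   Cmod (B' k x) <= theta ^ k / 2 * exp (2 * M / theta * (x + a)))%R.
Proof.
intros HM Ht Hb.
set (L := (2 * M / theta)%R).
assert (HL : (0 < L)%R) by (apply Rdiv_lt_0_compat; lra).
assert (HML : (M / L = theta / 2)%R) by (unfold L; field; lra).
assert (Hpow : forall n, (0 < theta ^ n)%R) by (intros n; apply pow_lt; lra).
assert (Hexp : forall y, (0 < exp (L * (y + a)))%R) by (intros y; apply exp_pos).
assert (step : forall n,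
  (forall x, segment a x -> Cmod (A n x) <= theta ^ n * exp (L * (x + a)))%R ->
  forall x, segment a x -> (Cmod (B n x) <= theta ^ S n / 2 * exp (L * (x + a)))%R).
{ intros n HAn x Hx; rewrite HB.
  replace (theta ^ S n / 2)%R with (theta ^ n * M / L)%R
    by (unfold Rdiv in *; rewrite Rmult_assoc, HML; simpl; field).
  apply Cmod_RInt_le_exp; auto.
  - specialize (Hpow n); nra.
  - apply continuous_on_Cmult; [apply iterated_continuous|exact Hq].
  - intros y Hy; rewrite Cmod_mult.
    replace (theta ^ n * M * exp (L * (y + a)))%R
      with (theta ^ n * exp (L * (y + a)) * M)%R by ring.
    apply Rmult_le_compat; auto using Cmod_ge_0; apply Hb; exact Hy. }
induction k as [|k IH]; intros x Hx.
- assert (H0 : forall y, segment a y ->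
    (Cmod (A 0%nat y) <= theta ^ 0 * exp (L * (y + a)))%R).
  { intros y [Hy _]; rewrite HA0, Cmod_1; simpl.
    assert (0 <= L * (y + a))%R by (apply Rmult_le_pos; lra).
    assert (H1 := exp_ineq1_le (L * (y + a))%R); lra. }
  split; [auto|split; [auto|]].
  rewrite HB'0, Cmod_0; simpl; specialize (Hexp x); lra.
- assert (H1 : forall y, segment a y ->
    (Cmod (A (S k) y) <= theta ^ S k * exp (L * (y + a)))%R).
  { intros y Hy; rewrite HA.
    apply Rle_trans with
      ((theta ^ S k / 2 * M + theta ^ k / 2 * M) / L * exp (L * (y + a)))%R.
    - apply Cmod_RInt_le_exp; auto.
      + assert (P1 := Hpow k); assert (P2 := Hpow (S k)); nra.
      + destruct (iterated_continuous k) as [_ [C1 C2]].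
        apply continuous_on_Cplus; apply continuous_on_Cmult; auto.
      + intros z Hz; destruct (IH z Hz) as [_ [G1 G2]].
        destruct (Hb z Hz) as [_ [G3 G4]].
        eapply Rle_trans; [apply Cmod_triangle|].
        rewrite !Cmod_mult.
        replace ((theta ^ S k / 2 * M + theta ^ k / 2 * M) * exp (L * (z + a)))%R
          with (theta ^ S k / 2 * exp (L * (z + a)) * M
                + theta ^ k / 2 * exp (L * (z + a)) * M)%R by ring.
        apply Rplus_le_compat; apply Rmult_le_compat; auto using Cmod_ge_0.
    - apply Rmult_le_compat_r; [left; auto|].
      replace ((theta ^ S k / 2 * M + theta ^ k / 2 * M) / L)%R
        with ((theta ^ S k + theta ^ k) / 2 * (M / L))%R by (field; lra).
      rewrite HML; simpl; specialize (Hpow k).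
      (* reduces to (theta + 1) / 4 <= 1 *)
      assert (0 <= theta ^ k * theta * (3 - theta))%R
        by (apply Rmult_le_pos; [apply Rmult_le_pos|]; lra).
      lra. }
  split; [auto|split; [auto|]].
  rewrite HB'S; apply IH; exact Hx.
Qed.

(** The power series in [lambda] with coefficients [B k] and [A k] solve the
    first-order system whose coefficientwise form is the recursion. *)
Lemma generating_functions (lambda : C) :
  exists u w : R -> C,
    (forall x, segment a x ->
      is_series (K := C_AbsRing) (V := C_NormedModule)
        (fun k => lambda ^ k * B k x) (u x) /\
      is_series (K := C_AbsRing) (V := C_NormedModule)
        (fun k => lambda ^ k * A k x) (w x) /\
      is_series (K := C_AbsRing) (V := C_NormedModule)
        (fun k => lambda ^ k * B' k x) (lambda * u x)) /\
    has_derivative a u (fun x => w x * q x) /\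
    has_derivative a w
      (fun x => lambda * u x * r x + lambda ^ 2 * u x * s x) /\
    u (- a)%R = 0 /\ w (- a)%R = 1.
Proof.
destruct (bounded_segment a q Ha Hq) as [Mq Bq].
destruct (bounded_segment a r Ha Hr) as [Mr Br].
destruct (bounded_segment a s Ha Hs) as [Ms Bs].
pose (M := (Rabs Mq + Rabs Mr + Rabs Ms + 1)%R).
assert (P1 := Rabs_pos Mq); assert (P2 := Rabs_pos Mr); assert (P3 := Rabs_pos Ms).
assert (Q1 := Rle_abs Mq); assert (Q2 := Rle_abs Mr); assert (Q3 := Rle_abs Ms).
assert (HM : (0 < M)%R) by (unfold M; lra).
assert (Hb : forall x, segment a x ->
  (Cmod (q x) <= M /\ Cmod (r x) <= M /\ Cmod (s x) <= M)%R).
{ intros x Hx; specialize (Bq x Hx); specialize (Br x Hx); specialize (Bs x Hx).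
  unfold M; lra. }
assert (Hl := Cmod_ge_0 lambda).
(* theta is chosen so that |lambda| theta <= 1/2. *)
pose (theta := (/ (2 * (Cmod lambda + 1)))%R).
assert (Hth : (0 < theta <= 1)%R).
{ unfold theta; split; [apply Rinv_0_lt_compat; lra|].
  rewrite <- Rinv_1; apply Rinv_le_contravar; lra. }
assert (Hlt : (Cmod lambda * theta <= 1 / 2)%R).
{ unfold theta; apply Rmult_le_reg_r with (2 * (Cmod lambda + 1))%R; [lra|].
  rewrite Rmult_assoc, Rinv_l; lra. }
assert (HB1 := iterated_bound M theta HM Hth Hb).
(* E is the largest value of the weight on the segment. *)
pose (E := exp (2 * M / theta * (a + a))).
assert (HE : forall x, segment a x -> (exp (2 * M / theta * (x + a)) <= E)%R).
{ intros x [_ Hx]; unfold E; destruct Hx as [Hx|<-]; [left|right; reflexivity].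
  apply exp_increasing, Rmult_lt_compat_l; [apply Rdiv_lt_0_compat; lra|lra]. }
assert (HE0 : (0 < E)%R) by apply exp_pos.
assert (Hpow : forall n, (0 < theta ^ n)%R) by (intros n; apply pow_lt; lra).
assert (Hgeo : forall k, (Cmod lambda ^ k * theta ^ k <= (1 / 2) ^ k)%R).
{ intros k; rewrite <- Rpow_mult_distr; apply pow_incr; split; [nra|exact Hlt]. }
assert (Hlk : forall k, (0 <= Cmod lambda ^ k)%R) by (intros k; apply pow_le; exact Hl).
destruct (series_RInt_geom a (fun k x => lambda ^ k * (A k x * q x)) (E * M) Ha)
  as [g1 [Cg1 Hg1]].
{ intros k; apply continuous_on_Cmult; [apply continuous_on_Cconst|].
  apply continuous_on_Cmult; [apply iterated_continuous|exact Hq]. }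
{ intros k x Hx; rewrite !Cmod_mult, Cmod_pow.
  destruct (HB1 k x Hx) as [G _]; destruct (Hb x Hx) as [Gq _].
  apply Rle_trans with (Cmod lambda ^ k * (theta ^ k * E * M))%R.
  - apply Rmult_le_compat_l; [auto|].
    apply Rmult_le_compat; auto using Cmod_ge_0.
    apply Rle_trans with (1 := G); apply Rmult_le_compat_l; [left; auto|auto].
  - replace (Cmod lambda ^ k * (theta ^ k * E * M))%R
      with (E * M * (Cmod lambda ^ k * theta ^ k))%R by ring.
    apply Rmult_le_compat_l; [nra|auto]. }
destruct (series_RInt_geom a
  (fun k x => lambda ^ S k * (B k x * r x + B' k x * s x)) (Cmod lambda * (E * M)) Ha)
  as [g2 [Cg2 Hg2]].
{ intros k; apply continuous_on_Cmult; [apply continuous_on_Cconst|].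
  destruct (iterated_continuous k) as [_ [C1 C2]].
  apply continuous_on_Cplus; apply continuous_on_Cmult; auto. }
{ intros k x Hx; rewrite Cmod_mult, Cmod_pow.
  destruct (HB1 k x Hx) as [_ [G1 G2]]; destruct (Hb x Hx) as [_ [Gr Gs]].
  assert (He := HE x Hx); assert (Hp := Hpow k).
  assert (G3 : (Cmod (B k x * r x + B' k x * s x) <= theta ^ k * E * M)%R).
  { eapply Rle_trans; [apply Cmod_triangle|]; rewrite !Cmod_mult.
    replace (theta ^ k * E * M)%R
      with (theta ^ k / 2 * E * M + theta ^ k / 2 * E * M)%R by field.
    apply Rplus_le_compat; apply Rmult_le_compat; auto using Cmod_ge_0.
    - apply Rle_trans with (1 := G1); apply Rmult_le_compat; auto.
      + specialize (Hpow (S k)); lra.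
      + left; apply exp_pos.
      + simpl; nra.
    - apply Rle_trans with (1 := G2); apply Rmult_le_compat_l; [lra|auto]. }
  apply Rle_trans with (Cmod lambda ^ S k * (theta ^ k * E * M))%R.
  - apply Rmult_le_compat_l; auto.
  - replace (Cmod lambda ^ S k * (theta ^ k * E * M))%R
      with (Cmod lambda * (E * M) * (Cmod lambda ^ k * theta ^ k))%R by (simpl; ring).
    apply Rmult_le_compat_l; [|auto].
    apply Rmult_le_pos; [auto|nra]. }
pose (u := (fun x => RInt (V := C_R_CompleteNormedModule) g1 (- a)%R x) : R -> C).
pose (w1 := (fun x => RInt (V := C_R_CompleteNormedModule) g2 (- a)%R x) : R -> C).
pose (w := fun x => 1 + w1 x).
assert (su : forall x, segment a x ->
  is_series (K := C_AbsRing) (V := C_NormedModule) (fun k => lambda ^ k * B k x) (u x)).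
{ intros x Hx; destruct (Hg1 x Hx) as [_ H].
  revert H; apply is_series_C_ext; [|reflexivity].
  intros k; rewrite RInt_Cscal, <- HB; auto.
  apply continuous_on_Cmult; [apply iterated_continuous|exact Hq]. }
assert (sw : forall x, segment a x ->
  is_series (K := C_AbsRing) (V := C_NormedModule) (fun k => lambda ^ k * A k x) (w x)).
{ intros x Hx; destruct (Hg2 x Hx) as [_ H].
  apply (is_series_decr_1 (V := C_NormedModule)).
  revert H; apply is_series_C_ext.
  - intros k; rewrite RInt_Cscal, <- HA; auto.
    destruct (iterated_continuous k) as [_ [C1 C2]].
    apply continuous_on_Cplus; apply continuous_on_Cmult; auto.
  - change (w1 x = 1 + w1 x + - (lambda ^ 0 * A 0%nat x)); rewrite HA0; C_module_ring. }
assert (su' : forall x, segment a x ->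
  is_series (K := C_AbsRing) (V := C_NormedModule)
    (fun k => lambda ^ k * B' k x) (lambda * u x)).
{ intros x Hx.
  apply (is_series_decr_1 (V := C_NormedModule)).
  generalize (is_series_scal_l (V := C_NormedModule) lambda _ _ (su x Hx)).
  apply is_series_C_ext.
  - intros k; rewrite HB'S; C_module_ring.
  - rewrite HB'0; C_module_ring. }
exists u, w; split; [auto|].
split; [|split; [|split]].
- intros x Hx; replace (w x * q x) with (g1 x).
  { exact (has_derivative_RInt a g1 Ha Cg1 x Hx). }
  apply (is_series_C_unique _ _ _ (proj1 (Hg1 x Hx))).
  generalize (is_series_scal_l (V := C_NormedModule) (q x) _ _ (sw x Hx)).
  apply is_series_C_ext; intros; C_module_ring.
- intros x Hx.
  replace (lambda * u x * r x + lambda ^ 2 * u x * s x) with (0 + g2 x).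
  { apply is_derive_seg_plus; [exact Hx|apply is_derive_seg_const; exact Hx|].
    exact (has_derivative_RInt a g2 Ha Cg2 x Hx). }
  rewrite Cplus_0_l.
  apply (is_series_C_unique _ _ _ (proj1 (Hg2 x Hx))).
  generalize (is_series_plus (V := C_NormedModule) _ _ _ _
    (is_series_scal_l (V := C_NormedModule) (lambda * r x) _ _ (su x Hx))
    (is_series_scal_l (V := C_NormedModule) (lambda * s x) _ _ (su' x Hx))).
  apply is_series_C_ext; intros; C_module_ring.
- exact (RInt_point (V := C_R_CompleteNormedModule) (- a)%R g1).
- change (1 + w1 (- a)%R = 1).
  replace (w1 (- a)%R) with (RtoC 0)
    by exact (eq_sym (RInt_point (V := C_R_CompleteNormedModule) (- a)%R g2)).
  C_module_ring.
Qed.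

End Iterated.

(** * Uniqueness for the initial value problem *)

Lemma is_derive_Re (f : R -> C) (x : R) (l : C) :
  is_derive (V := C_R_NormedModule) f x l -> is_derive (fun y => Re (f y)) x (Re l).
Proof.
intros H.
exact (filterdiff_comp' (V := C_R_NormedModule) (W := R_NormedModule) f fst x _ _ H
  (filterdiff_linear (K := R_AbsRing) fst is_linear_fst)).
Qed.

Lemma is_derive_Im (f : R -> C) (x : R) (l : C) :
  is_derive (V := C_R_NormedModule) f x l -> is_derive (fun y => Im (f y)) x (Im l).
Proof.
intros H.
exact (filterdiff_comp' (V := C_R_NormedModule) (W := R_NormedModule) f snd x _ _ H
  (filterdiff_linear (K := R_AbsRing) snd is_linear_snd)).
Qed.

Lemma Re_Im_clamp (a : R) (f df : R -> C) :
  (0 < a)%R -> has_derivative a f df ->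
  (forall x, (- a < x < a)%R ->
     is_derive (fun y => Re (f (clamp a y))) x (Re (df x)) /\
     is_derive (fun y => Im (f (clamp a y))) x (Im (df x))) /\
  (forall x, continuity_pt (fun y => Re (f (clamp a y))) x /\
             continuity_pt (fun y => Im (f (clamp a y))) x).
Proof.
intros Ha Hf; split; intros x.
- intros Hx.
  assert (H : is_derive (V := C_R_NormedModule) (fun y => f (clamp a y)) x (df x)).
  { apply (is_derive_ext_loc (V := C_R_NormedModule) f).
    - generalize (open_and _ _ (open_gt (- a)%R) (open_lt a) x Hx).
      apply filter_imp; intros y Hy; rewrite clamp_id; [reflexivity|unfold segment; lra].
    - apply (is_derive_seg_interior a); [exact Hx|apply Hf; unfold segment; lra]. }
  split; [apply (is_derive_Re _ _ _ H)|apply (is_derive_Im _ _ _ H)].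
- assert (H := continuous_clamp a f x Ha (has_derivative_continuous_on _ _ _ Hf)).
  split; apply continuity_pt_filterlim.
  + exact (filterlim_comp _ _ _ _ fst _ _ _ H (continuous_fst _ _)).
  + exact (filterlim_comp _ _ _ _ snd _ _ _ H (continuous_snd _ _)).
Qed.

(** The energy |v1|^2 + |v2|^2 has derivative 2 Re lambda (|v1|^2 - |v2|^2): the
    coupling terms cancel because P is the conjugate of Q.  Weighted by
    exp (- 2 Re lambda x), it is therefore nonincreasing. *)
Lemma is_solution_zero (a : R) (P Q : R -> C) (lambda : C) (v1 v2 : R -> C) :
  (0 < a)%R -> (0 <= Re lambda)%R ->
  (forall x, segment a x -> P x = Cconj (Q x)) ->
  is_solution a P Q lambda v1 v2 ->
  v1 (- a)%R = 0 -> v2 (- a)%R = 0 ->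
  forall x, segment a x -> v1 x = 0 /\ v2 x = 0.
Proof.
intros Ha Hl HP [dv1 [dv2 [[D1 _] [[D2 _] E]]]] I1 I2 x Hx.
destruct (Re_Im_clamp a v1 dv1 Ha D1) as [R1 C1].
destruct (Re_Im_clamp a v2 dv2 Ha D2) as [R2 C2].
set (p1 := fun y => Re (v1 (clamp a y))) in *.
set (p2 := fun y => Im (v1 (clamp a y))) in *.
set (p3 := fun y => Re (v2 (clamp a y))) in *.
set (p4 := fun y => Im (v2 (clamp a y))) in *.
pose (G := fun y => (exp (- 2 * Re lambda * y)
                     * (p1 y ^ 2 + p2 y ^ 2 + p3 y ^ 2 + p4 y ^ 2))%R).
pose (dG := fun y => (- (4 * Re lambda * exp (- 2 * Re lambda * y)
                         * (p3 y ^ 2 + p4 y ^ 2)))%R).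
(* The derivative dG is nonpositive everywhere, so the location of the
   intermediate point c is irrelevant. *)
destruct (MVT_gen G (- a)%R x dG) as [c [_ Hc]].
- unfold segment in Hx; rewrite Rmin_left, Rmax_right by lra; intros y Hy.
  assert (Hy' : (- a < y < a)%R) by lra.
  assert (Sy : segment a y) by (unfold segment; lra).
  destruct (E y Hy') as [E1 E2]; rewrite (HP y Sy) in E1.
  destruct (R1 y Hy') as [d1 d2]; destruct (R2 y Hy') as [d3 d4].
  unfold G, dG; auto_derive.
  + repeat split; eexists; eassumption.
  + replace (Derive (fun y => p1 y) y) with (Re (dv1 y))
      by (symmetry; apply is_derive_unique; exact d1).
    replace (Derive (fun y => p2 y) y) with (Im (dv1 y))
      by (symmetry; apply is_derive_unique; exact d2).
    replace (Derive (fun y => p3 y) y) with (Re (dv2 y))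
      by (symmetry; apply is_derive_unique; exact d3).
    replace (Derive (fun y => p4 y) y) with (Im (dv2 y))
      by (symmetry; apply is_derive_unique; exact d4).
    rewrite E1, E2; unfold p1, p2, p3, p4; rewrite clamp_id by exact Sy.
    destruct (v1 y) as [a1 a2]; destruct (v2 y) as [a3 a4].
    destruct (Q y) as [q1 q2]; destruct lambda as [l1 l2]; simpl; ring.
- intros y _; unfold G.
  destruct (C1 y) as [c1 c2]; destruct (C2 y) as [c3 c4].
  assert (sq : forall p : R -> R, continuity_pt p y ->
    continuity_pt (fun z => p z ^ 2)%R y).
  { intros p Hp; apply (continuity_pt_ext (fun z => p z * p z)%R).
    - intros z; ring.
    - exact (continuity_pt_mult p p y Hp Hp). }
  apply (continuity_pt_mult (fun z => exp (- 2 * Re lambda * z))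
    (fun z => p1 z ^ 2 + p2 z ^ 2 + p3 z ^ 2 + p4 z ^ 2)%R).
  + apply continuity_pt_filterlim.
    apply (ex_derive_continuous (fun z => exp (- 2 * Re lambda * z))).
    auto_derive; exact I.
  + apply (continuity_pt_plus (fun z => p1 z ^ 2 + p2 z ^ 2 + p3 z ^ 2)%R
      (fun z => p4 z ^ 2)%R); [|auto].
    apply (continuity_pt_plus (fun z => p1 z ^ 2 + p2 z ^ 2)%R
      (fun z => p3 z ^ 2)%R); [|auto].
    apply (continuity_pt_plus (fun z => p1 z ^ 2)%R (fun z => p2 z ^ 2)%R); auto.
- assert (Ga : G (- a)%R = 0%R).
  { unfold G, p1, p2, p3, p4; rewrite clamp_id by (unfold segment; lra).
    rewrite I1, I2; simpl; ring. }
  assert (Hd : (dG c * (x - - a) <= 0)%R).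
  { unfold segment in Hx.
    assert (0 <= 4 * Re lambda * exp (- 2 * Re lambda * c) * (p3 c ^ 2 + p4 c ^ 2))%R.
    { assert (H := exp_pos (- 2 * Re lambda * c)).
      apply Rmult_le_pos; [apply Rmult_le_pos; lra|].
      assert (H3 := pow2_ge_0 (p3 c)); assert (H4 := pow2_ge_0 (p4 c)); lra. }
    unfold dG; nra. }
  assert (HG : (p1 x ^ 2 + p2 x ^ 2 + p3 x ^ 2 + p4 x ^ 2 <= 0)%R).
  { apply Rmult_le_reg_l with (exp (- 2 * Re lambda * x)); [apply exp_pos|].
    change (G x <= exp (- 2 * Re lambda * x) * 0)%R; lra. }
  assert (H1 := pow2_ge_0 (p1 x)); assert (H2 := pow2_ge_0 (p2 x)).
  assert (H3 := pow2_ge_0 (p3 x)); assert (H4 := pow2_ge_0 (p4 x)).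
  assert (Z : forall t : R, (t ^ 2 <= 0)%R -> t = 0%R) by (intros t Ht; nra).
  split; apply injective_projections; simpl; rewrite <- (clamp_id a x Hx);
    apply Z; fold (p1 x) (p2 x) (p3 x) (p4 x).
  + change (p1 x ^ 2 <= 0)%R; lra.
  + change (p2 x ^ 2 <= 0)%R; lra.
  + change (p3 x ^ 2 <= 0)%R; lra.
  + change (p4 x ^ 2 <= 0)%R; lra.
Qed.

Lemma C1_seg_minus (a : R) (f g df dg : R -> C) :
  C1_seg a f df -> C1_seg a g dg ->
  C1_seg a (fun x => f x + - (1) * g x) (fun x => df x + - (1) * dg x).
Proof.
intros [Df Cf] [Dg Cg]; split.
- intros x Hx.
  replace (df x + - (1) * dg x) with (df x + (0 * g x + - (1) * dg x)) by ring.
  apply is_derive_seg_plus; auto.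
  apply is_derive_seg_mult; auto; apply is_derive_seg_const; exact Hx.
- apply continuous_on_Cplus; [exact Cf|].
  apply continuous_on_Cmult; [apply continuous_on_Cconst|exact Cg].
Qed.

Lemma is_solution_unique (a : R) (P Q : R -> C) (lambda : C)
    (v1 v2 z1 z2 : R -> C) :
  (0 < a)%R -> (0 <= Re lambda)%R ->
  (forall x, segment a x -> P x = Cconj (Q x)) ->
  is_solution a P Q lambda v1 v2 -> is_solution a P Q lambda z1 z2 ->
  v1 (- a)%R = z1 (- a)%R -> v2 (- a)%R = z2 (- a)%R ->
  forall x, segment a x -> v1 x = z1 x /\ v2 x = z2 x.
Proof.
intros Ha Hl HP [dv1 [dv2 [A1 [A2 A]]]] [dz1 [dz2 [B1 [B2 B]]]] I1 I2 x Hx.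
destruct (is_solution_zero a P Q lambda
  (fun x => v1 x + - (1) * z1 x) (fun x => v2 x + - (1) * z2 x)) with (x := x)
  as [H1 H2]; auto.
- exists (fun x => dv1 x + - (1) * dz1 x), (fun x => dv2 x + - (1) * dz2 x).
  split; [apply C1_seg_minus; auto|split; [apply C1_seg_minus; auto|]].
  intros y Hy; destruct (A y Hy) as [-> ->]; destruct (B y Hy) as [-> ->].
  split; ring.
- rewrite I1; ring.
- rewrite I2; ring.
- split.
  + replace (v1 x) with (v1 x + - (1) * z1 x + z1 x) by ring; rewrite H1; ring.
  + replace (v2 x) with (v2 x + - (1) * z2 x + z2 x) by ring; rewrite H2; ring.
Qed.

(** * The solution of the initial value problem *)

(** If u' = w Q / v0^2 and w' = lambda u v0^2 Q' / Q^2 + lambda^2 u v0^2 / Q,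
    then v2 = c v0 u satisfies the second-order equation for the second component of
    a solution, and v1 = - (v2' + lambda v2) / Q is the first component; it is
    written below with v2' expressed through [u] and [w]. *)
Lemma is_solution_of_generating_functions (a : R) (Q P dQ v0 dv0 dw0 u w : R -> C)
    (lambda c : C) :
  continuous_on (segment a) Q ->
  (forall x, segment a x -> Q x <> 0) ->
  (forall x, segment a x -> P x = Cconj (Q x)) ->
  has_derivative a Q dQ ->
  (forall x, segment a x -> v0 x <> 0) ->
  has_derivative a v0 dv0 ->
  has_derivative a (fun x => dv0 x / Q x) dw0 ->
  (forall x, segment a x -> dw0 x + P x * v0 x = 0) ->
  has_derivative a u (fun x => w x * (Q x / v0 x ^ 2)) ->
  has_derivative a w (fun x =>
    lambda * u x * (v0 x ^ 2 * (dQ x / Q x ^ 2)) + lambda ^ 2 * u x * (v0 x ^ 2 / Q x)) ->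
  is_solution a P Q lambda
    (fun x => - c * (dv0 x / Q x * u x + w x * / v0 x + lambda * (v0 x * u x * / Q x)))
    (fun x => c * (v0 x * u x)).
Proof.
intros CQ Q0 HP DQ v00 Dv0 Dw0 Ew Du Dw.
set (v1 := fun x => - c * _).
set (v2 := fun x => c * _).
assert (D1 : has_derivative a v1 (fun x => lambda * v1 x + P x * v2 x)).
{ intros x Hx.
  assert (Qx := Q0 x Hx); assert (v0x := v00 x Hx).
  assert (Ex : dw0 x = - (P x * v0 x)).
  { replace (dw0 x) with (dw0 x + P x * v0 x - P x * v0 x) by ring.
    rewrite (Ew x Hx); ring. }
  assert (H := is_derive_seg_mult a (fun _ => - c) _ x _ _ Hx
    (is_derive_seg_const a (- c) x Hx)
    (is_derive_seg_plus a _ _ x _ _ Hx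
      (is_derive_seg_plus a _ _ x _ _ Hx
        (is_derive_seg_mult a _ _ x _ _ Hx (Dw0 x Hx) (Du x Hx))
        (is_derive_seg_mult a _ _ x _ _ Hx (Dw x Hx)
          (is_derive_seg_inv a _ x _ Hx v00 (Dv0 x Hx))))
      (is_derive_seg_mult a _ _ x _ _ Hx (is_derive_seg_const a lambda x Hx)
        (is_derive_seg_mult a _ _ x _ _ Hx
          (is_derive_seg_mult a _ _ x _ _ Hx (Dv0 x Hx) (Du x Hx))
          (is_derive_seg_inv a _ x _ Hx Q0 (DQ x Hx)))))).
  cbv beta in H; rewrite Ex in H.
  match type of H with is_derive_seg _ _ _ ?l =>
    replace (lambda * v1 x + P x * v2 x) with l; [exact H|] end.
  unfold v1, v2; field; auto. }
assert (D2 : has_derivative a v2 (fun x => - lambda * v2 x - Q x * v1 x)).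
{ intros x Hx.
  assert (Qx := Q0 x Hx); assert (v0x := v00 x Hx).
  assert (H := is_derive_seg_mult a (fun _ => c) _ x _ _ Hx
    (is_derive_seg_const a c x Hx)
    (is_derive_seg_mult a _ _ x _ _ Hx (Dv0 x Hx) (Du x Hx))).
  cbv beta in H.
  match type of H with is_derive_seg _ _ _ ?l =>
    replace (- lambda * v2 x - Q x * v1 x) with l; [exact H|] end.
  unfold v1, v2; field; auto. }
assert (C1 := has_derivative_continuous_on _ _ _ D1).
assert (C2 := has_derivative_continuous_on _ _ _ D2).
exists (fun x => lambda * v1 x + P x * v2 x), (fun x => - lambda * v2 x - Q x * v1 x).
split; [|split; [|auto]]; split; auto.
- apply continuous_on_Cplus; apply continuous_on_Cmult; auto using continuous_on_Cconst.
  apply (continuous_on_C_ext a (fun x => Cconj (Q x))).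
  + intros x Hx; symmetry; auto.
  + intros x Hx; apply filterlim_Cconj; auto.
- apply (continuous_on_C_ext a (fun x => - lambda * v2 x + - (1) * (Q x * v1 x))).
  { intros x _; ring. }
  assert (CQv := continuous_on_Cmult a Q v1 CQ C1).
  apply continuous_on_Cplus; apply continuous_on_Cmult;
    auto using continuous_on_Cconst.
Qed.

(** * Characterization of the eigenvalues *)

Theorem theorem4p5 :
  forall (a : R) (Q P dQ : R -> C) (v0 dv0 dw0 : R -> C),
  (0 < a)%R ->
  continuous_on (segment a) Q ->
  (forall x, segment a x -> Q x <> 0) ->
  (forall x, segment a x -> P x = Cconj (Q x)) ->
  has_derivative a Q dQ ->
  (forall x, segment a x -> v0 x <> 0) ->
  C1_seg a v0 dv0 ->
  C1_seg a (fun x => dv0 x / Q x) dw0 ->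
  (forall x, segment a x -> dw0 x + P x * v0 x = 0) ->
  continuous_on (segment a) (fun x => v0 x ^ 2 * (dQ x / Q x ^ 2)) ->
  continuous_on (segment a) (fun x => v0 x ^ 2 / Q x) ->
  continuous_on (segment a) (fun x => Q x / v0 x ^ 2) ->
  forall lambda : C, (0 < Re lambda)%R ->
  (is_eigenvalue a P Q lambda <->
   is_series (K := C_AbsRing) (V := C_NormedModule)
     (fun k : nat =>
        lambda ^ k *
        (v0 a * (dv0 a * X a Q dQ v0 (2 * Z.of_nat k + 1) a
                 + v0 a * X a Q dQ v0 (2 * Z.of_nat k - 1) a)
         + Q a * X a Q dQ v0 (2 * Z.of_nat k) a))
     (0 : C)).
Proof.
intros a Q P dQ v0 dv0 dw0 Ha CQ Q0 HP DQ v00 [Dv0 _] [Dw0 _] Ew Cr Cs Cq lambda Hl.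
destruct (generating_functions a
  (fun x => Q x / v0 x ^ 2) (fun x => v0 x ^ 2 * (dQ x / Q x ^ 2))
  (fun x => v0 x ^ 2 / Q x)
  (fun k => X a Q dQ v0 (2 * Z.of_nat k))
  (fun k => X a Q dQ v0 (2 * Z.of_nat k + 1))
  (fun k => X a Q dQ v0 (2 * Z.of_nat k - 1)) Ha Cq Cr Cs) with (lambda := lambda)
  as [u [w [Hser [Du [Dw [u0 w0]]]]]].
- intros x; apply X_0.
- intros x; apply X_neg; lia.
- intros k x; f_equal; lia.
- intros k x; rewrite X_odd; [|lia|].
  + apply (RInt_ext (V := C_R_CompleteNormedModule)); intros y _.
    now replace (2 * Z.of_nat k + 1 - 1)%Z with (2 * Z.of_nat k)%Z by lia.
  + apply Z.odd_spec; exists (Z.of_nat k); reflexivity.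
- intros k x; rewrite X_even; [|lia|].
  + apply (RInt_ext (V := C_R_CompleteNormedModule)); intros y _.
    replace (2 * Z.of_nat (S k) - 1)%Z with (2 * Z.of_nat k + 1)%Z by lia.
    now replace (2 * Z.of_nat (S k) - 3)%Z with (2 * Z.of_nat k - 1)%Z by lia.
  + apply Z.even_spec; exists (Z.of_nat (S k)); reflexivity.
- assert (Sa : segment a a) by (unfold segment; lra).
  assert (Sa' : segment a (- a)%R) by (unfold segment; lra).
  assert (Qa := Q0 a Sa); assert (v0a := v00 a Sa); assert (v0a' := v00 _ Sa').
  assert (Qa' := Q0 _ Sa').
  (* This factor gives the first component the value 1 at the left endpoint. *)
  pose (c := - v0 (- a)%R).
  assert (Sol := is_solution_of_generating_functions a Q P dQ v0 dv0 dw0 u w lambda c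
    CQ Q0 HP DQ v00 Dv0 Dw0 Ew Du Dw).
  set (z1 := fun x => - c * _) in Sol.
  set (z2 := fun x => c * _) in Sol.
  (* The sum of the series of the theorem. *)
  pose (sigma := v0 a * (dv0 a * u a + v0 a * (lambda * u a)) + Q a * w a).
  assert (Hsigma : is_series (K := C_AbsRing) (V := C_NormedModule)
     (fun k : nat =>
        lambda ^ k *
        (v0 a * (dv0 a * X a Q dQ v0 (2 * Z.of_nat k + 1) a
                 + v0 a * X a Q dQ v0 (2 * Z.of_nat k - 1) a)
         + Q a * X a Q dQ v0 (2 * Z.of_nat k) a)) sigma).
  { destruct (Hser a Sa) as [su [sw su']].
    generalize (is_series_plus (V := C_NormedModule) _ _ _ _
      (is_series_plus (V := C_NormedModule) _ _ _ _
        (is_series_scal_l (V := C_NormedModule) (v0 a * dv0 a) _ _ su)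
        (is_series_scal_l (V := C_NormedModule) (v0 a * v0 a) _ _ su'))
      (is_series_scal_l (V := C_NormedModule) (Q a) _ _ sw)).
    apply is_series_C_ext; intros; unfold sigma; C_module_ring. }
  assert (z1a : z1 a = v0 (- a)%R / (Q a * v0 a) * sigma).
  { unfold z1, sigma, c; field; auto. }
  assert (i1 : z1 (- a)%R = 1).
  { unfold z1, c; rewrite u0, w0; field; auto. }
  assert (i2 : z2 (- a)%R = 0).
  { unfold z2; rewrite u0; ring. }
  split.
  + intros [_ [v1 [v2 [Sv [I1 [I2 I3]]]]]].
    destruct (is_solution_unique a P Q lambda v1 v2 z1 z2 Ha ltac:(lra) HP Sv Sol)
      with (x := a) as [H _]; auto; try congruence.
    assert (E : sigma = 0).
    { replace sigma with (Q a * v0 a / v0 (- a)%R * z1 a)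
        by (rewrite z1a; field; auto).
      rewrite <- H, I3; ring. }
    rewrite <- E; exact Hsigma.
  + intros H0; split; [exact Hl|].
    exists z1, z2; split; [exact Sol|split; [exact i1|split; [exact i2|]]].
    rewrite z1a, (is_series_C_unique _ _ _ Hsigma H0); ring.
Qed.
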